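(* Let $H$ be a finite dimensional Hilbert space, $\varrho$ an invertible density matrix on $H$, $(x_i)$ an orthonormal basis of $H$ consisting of eigenvectors of $\varrho$, and $a\mapsto a^t$ the transposition on $\mathcal{B}(H)$ with respect to $(x_i)$. Let $H_\pi$ be $\mathcal{B}(H)$ with the Hilbert–Schmidt inner product, and let $\tau$ be the linear operator on $H_\pi$ defined by $\tau(a\varrho^{1/2})=a^t\varrho^{1/2}$ for $a\in\mathcal{B}(H)$. Then $\tau=U\Delta^{1/2}$, where $\Delta$ is the modular operator and $U$ is the unitary on $H_\pi$ with $U E_{ij}=E_{ji}$.
   Context: Inner products are linear in the second variable. $H_\pi=\mathcal{B}(H)$ with $(a,b)=\mathrm{Tr}(a^*b)$; it is the GNS space of the faithful state $\omega(a)=\mathrm{Tr}(\varrho a)$ with cyclic vector $\Omega=\varrho^{1/2}$ and representation by left multiplication. $E_{ij}=|x_i\rangle\langle x_j|$ form an orthonormal basis of $H_\pi$. The modular operator is $\Delta\xi=\varrho\,\xi\,\varrho^{-1}$. The transposition is $a^t=J_ca^*J_c$ with $J_cf=\sum_i\overline{\langle x_i,f\rangle}x_i$. *)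

(* Defs.v *)
From mathcomp Require Import all_boot all_order all_algebra.
From mathcomp Require Import complex.
From mathcomp Require Import boolp classical_sets reals.

Set Implicit Arguments.
Unset Strict Implicit.
Unset Printing Implicit Defensive.

Import Order.TTheory GRing.Theory Num.Theory Num.Def.

Local Open Scope ring_scope.

(* The library's positive definite forms are linear in the first argument and
   antilinear in the second one; the inner product here is linear in the
   second argument, hence the swap. *)
Definition inner (C : numClosedFieldType) (V : vectType C)
    (form : {dot V for conjC}) (f g : V) : C := form g f.

(* Operators on a finite-dimensional space V, for an inner product [ip] on V.
   It is a plain function, so that the same definitions apply to H and to
   'End(H) with the Hilbert-Schmidt inner product. *)
Section Operators.
Variables (C : numClosedFieldType) (V : vectType C) (ip : V -> V -> C).
Implicit Types a b u : 'End(V).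

(* Basis independent: [vbasis fullv] is an arbitrary basis of V. *)
Definition optrace a : C :=
  \sum_i coord (vbasis (fullv : {vspace V})) i (a (vbasis fullv)`_i).

(* The default value 0 of [xget] is irrelevant when [ip] is an inner product:
   the adjoint then exists and is unique. *)
Definition adjoint a : 'End(V) :=
  xget 0 [set b : 'End(V) | forall f g : V, ip (b f) g = ip f (a g)]%classic.

(* [0 <= z] in C entails that z is real. *)
Definition positive_op a : Prop := forall f : V, 0 <= ip f (a f).

(* The positive square root; it exists and is unique when a is positive. *)
Definition oproot a : 'End(V) :=
  xget 0 [set b : 'End(V) | positive_op b /\ (b \o b)%VF = a]%classic.

Definition unitary_op u : Prop :=
  (adjoint u \o u)%VF = \1%VF /\ (u \o adjoint u)%VF = \1%VF.

Definition density_op a : Prop := positive_op a /\ optrace a = 1.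

Definition ketbra (x y : V) : 'End(V) := linfun (fun f => ip y f *: x).

(* The antilinear conjugation J_c with respect to the basis x. *)
Definition conj_op n (x : n.-tuple V) (f : V) : V :=
  \sum_(i < n) (ip (tnth x i) f)^* *: tnth x i.

(* a^t = J_c a^* J_c, which is linear although J_c is antilinear. *)
Definition transpose_op n (x : n.-tuple V) a : 'End(V) :=
  linfun (fun f => conj_op x (adjoint a (conj_op x f))).

Definition hilbert_schmidt (a b : 'End(V)) : C := optrace (adjoint a \o b)%VF.

Definition modular_op (rho : 'End(V)) : 'End('End(V)) :=
  linfun (fun xi : 'End(V) => (rho \o xi \o rho^-1)%VF).

End Operators.

(* Main.v *)
(* With respect to the orthonormal basis E_ij of the Hilbert-Schmidt space, the
   modular operator is diagonal with eigenvalues l_i / l_j > 0, where l_i are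
   the eigenvalues of rho; since positive square roots are unique, its square
   root is xi |-> r xi r^-1 with r = rho^(1/2).  The flip U is the
   transposition, which reverses products and fixes r, so that
   U (Delta^(1/2) (a r)) = (r a)^t = a^t r = tau (a r). *)
From HB Require Import structures.
Require Import Defs.
From mathcomp Require Import all_boot all_order all_algebra.
From mathcomp Require Import complex.
From mathcomp Require Import boolp classical_sets reals.

Set Implicit Arguments.
Unset Strict Implicit.
Unset Printing Implicit Defensive.

Import Order.TTheory GRing.Theory Num.Theory Num.Def.

Local Open Scope ring_scope.

(** The operators in the definitions are [linfun] of bare functions, so each evaluation has to be
    paid for with a proof of linearity. *)
Lemma linfun_linearE (K : fieldType) (U V : vectType K) (f : U -> V) :
  linear f -> linfun f =1 f.
Proof.
move=> linf; pose L := GRing.isLinear.Build K U V *:%R f linf.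
pose F : {linear U -> V} := HB.pack f L.
exact: (lfunE F).
Qed.

(* The expansion property makes [ip] nondegenerate, so that positive
   definiteness need not be assumed. *)
Definition orthonormal_basis (C : numClosedFieldType) (V : vectType C)
    (ip : V -> V -> C) (I : finType) (e : I -> V) : Prop :=
  [/\ forall f c g h, ip f (c *: g + h) = c * ip f g + ip f h,
      forall f g, (ip g f)^* = ip f g,
      forall i j, ip (e i) (e j) = (i == j)%:R
    & forall f, f = \sum_i ip (e i) f *: e i].

(** * Expansions, adjoints and traces in an orthonormal basis *)

Section OrthonormalBasis.
Variables (C : numClosedFieldType) (V : vectType C) (ip : V -> V -> C).
Variables (I : finType) (e : I -> V).
Hypothesis onb : orthonormal_basis ip e.
Implicit Types (a b : 'End(V)) (f g h : V).

Lemma ip_conj f g : (ip g f)^* = ip f g.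
Proof. by case: onb. Qed.

Lemma ip_onb i j : ip (e i) (e j) = (i == j)%:R.
Proof. by case: onb. Qed.

Lemma onb_expand f : f = \sum_i ip (e i) f *: e i.
Proof. by case: onb. Qed.

Lemma ipDr f g h : ip f (g + h) = ip f g + ip f h.
Proof. by case: onb => lin _ _ _; have := lin f 1 g h; rewrite scale1r mul1r. Qed.

Lemma ip0r f : ip f 0 = 0.
Proof. by apply: (@addrI _ (ip f 0)); rewrite -ipDr !addr0. Qed.

Lemma ipZr f c g : ip f (c *: g) = c * ip f g.
Proof. by case: onb => lin _ _ _; have := lin f c g 0; rewrite ip0r !addr0. Qed.

Lemma ip_sumr f (J : finType) (F : J -> V) :
  ip f (\sum_j F j) = \sum_j ip f (F j).
Proof. exact: (big_morph (ip f) (ipDr f) (ip0r f)). Qed.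

Lemma ipZl f c g : ip (c *: f) g = c^* * ip f g.
Proof. by rewrite -ip_conj ipZr rmorphM /= ip_conj. Qed.

Lemma ip_suml f (J : finType) (F : J -> V) :
  ip (\sum_j F j) f = \sum_j ip (F j) f.
Proof.
rewrite -ip_conj ip_sumr rmorph_sum; apply: eq_bigr => j _. exact: ip_conj.
Qed.

Lemma ip_coord f g : ip f g = \sum_i ip f (e i) * ip (e i) g.
Proof.
by rewrite {1}[g]onb_expand ip_sumr; apply: eq_bigr => i _; rewrite ipZr mulrC.
Qed.

Lemma ip_expand (c : I -> C) i : ip (e i) (\sum_j c j *: e j) = c i.
Proof.
rewrite ip_sumr (bigD1 i) //= ipZr ip_onb eqxx mulr1 big1 ?addr0 // => j ji.
by rewrite ipZr ip_onb eq_sym (negPf ji) mulr0.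
Qed.

Lemma onb_inj f g : (forall i, ip (e i) f = ip (e i) g) -> f = g.
Proof.
by move=> fg; rewrite [f]onb_expand [g]onb_expand; apply: eq_bigr => i _; rewrite fg.
Qed.

Lemma ip_ge0 f : 0 <= ip f f.
Proof.
rewrite ip_coord; apply: sumr_ge0 => i _.
by rewrite -(ip_conj f) mulrC mul_conjC_ge0.
Qed.

Lemma ip_eq0 f : ip f f = 0 -> f = 0.
Proof.
move=> ff0; apply: onb_inj => i; rewrite ip0r; move: ff0; rewrite ip_coord.
move/eqP; rewrite psumr_eq0; last first.
  by move=> j _; rewrite -(ip_conj f) mulrC mul_conjC_ge0.
move=> /allP/(_ i (mem_index_enum _)) /=.
by rewrite -(ip_conj f) mulrC mul_conjC_eq0 => /eqP.
Qed.

Lemma onb_lfunP a b : (forall i, a (e i) = b (e i)) -> a = b.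
Proof.
move=> ab; apply/lfunP => f; rewrite [f]onb_expand !linear_sum.
by apply: eq_bigr => i _; rewrite !linearZ /= ab.
Qed.

(** Coefficients in [e] determine a vector, so whatever witness [xget] picks agrees with [b]. *)
Lemma adjoint_unique a b : (forall f g, ip (b f) g = ip f (a g)) -> adjoint ip a = b.
Proof.
move=> ba; apply: xget_unique => // c ca; apply/lfunP => f; apply: onb_inj => i.
by rewrite -!(ip_conj (e i)) ba ca.
Qed.

Lemma adjointE a f g : ip (adjoint ip a f) g = ip f (a g).
Proof.
(* The coefficient of a^* h at e_i has to be <e_i, a^* h> = <a e_i, h>. *)
pose F h := \sum_i ip (a (e i)) h *: e i.
have linF : linear F.
  move=> c u v; rewrite /F scaler_sumr -big_split; apply: eq_bigr => i _ /=.
  by rewrite ipDr ipZr scalerDl scalerA.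
have FE h k : ip (linfun F h) k = ip h (a k).
  rewrite (linfun_linearE linF) /F ip_suml {2}[k]onb_expand linear_sum ip_sumr.
  by apply: eq_bigr => i _; rewrite linearZ ipZl ipZr ip_conj mulrC.
by rewrite (adjoint_unique FE).
Qed.

Lemma adjointEr a f g : ip g (adjoint ip a f) = ip (a g) f.
Proof. by rewrite -ip_conj adjointE ip_conj. Qed.

(** Expand each vector of [vbasis] in [e] and exchange the sums: the coordinates of a e_i along
    [vbasis] then reassemble to a e_i. *)
Lemma optraceE a : optrace a = \sum_i ip (e i) (a (e i)).
Proof.
have full : basis_of fullv (vbasis (fullv : {vspace V})) by exact: vbasisP.
rewrite /optrace.
under eq_bigr => k _.
  rewrite [(vbasis fullv)`_k]onb_expand !linear_sum /=.
  under eq_bigr => i _ do rewrite !linearZ /=.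
  over.
rewrite exchange_big; apply: eq_bigr => i _ /=.
rewrite [in RHS](coord_basis full (memvf (a (e i)))) ip_sumr.
by apply: eq_bigr => k _; rewrite ipZr mulrC.
Qed.

(** * Positive diagonal operators and their roots *)

Lemma eigen_positive a (l : I -> C) :
  (forall i, a (e i) = l i *: e i) -> (forall i, 0 <= l i) -> positive_op ip a.
Proof.
move=> ae l0 f; rewrite {2}[f]onb_expand linear_sum ip_sumr; apply: sumr_ge0 => i _.
by rewrite linearZ /= ae !ipZr -(ip_conj f) mulrCA mulr_ge0 // mul_conjC_ge0.
Qed.

(* If [b] is another positive root and [w = b (e i) - s i *: e i], then
   [(b + s i) w = 0], so positivity of [b] and [s i > 0] force [w = 0]. *)
Lemma oproot_eigen a b (s : I -> C) :
  (forall i, b (e i) = s i *: e i) -> (forall i, 0 < s i) ->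
  (forall i, a (e i) = s i ^+ 2 *: e i) -> oproot ip a = b.
Proof.
move=> be s0 ae; apply: xget_unique.
  split; first by apply: (eigen_positive be) => i; apply: ltW.
  by apply: onb_lfunP => i; rewrite comp_lfunE be linearZ /= be ae scalerA.
move=> c [cpos cc]; apply: onb_lfunP => i; rewrite be.
pose w := c (e i) - s i *: e i.
have cw : c w = - (s i *: w).
  rewrite /w linearB linearZ /= -comp_lfunE cc ae scalerBr scalerA opprB.
  by rewrite expr2.
have := cpos w; rewrite cw -scaleNr ipZr mulNr oppr_ge0 pmulr_rle0 // => ww.
apply/eqP; rewrite -subr_eq0; apply/eqP/ip_eq0/le_anti.
by rewrite ww ip_ge0.
Qed.

(** * Matrix units in the Hilbert-Schmidt space *)

Lemma ketbraE f g h : ketbra ip f g h = ip g h *: f.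
Proof.
rewrite /ketbra linfun_linearE // => c u v.
by rewrite ipDr ipZr scalerDl scalerA.
Qed.

Lemma ketbra_onbE i j k : ketbra ip (e i) (e j) (e k) = (j == k)%:R *: e i.
Proof. by rewrite ketbraE ip_onb. Qed.

Lemma hilbert_schmidtE a b :
  hilbert_schmidt ip a b = \sum_i ip (a (e i)) (b (e i)).
Proof.
rewrite /hilbert_schmidt optraceE; apply: eq_bigr => i _.
by rewrite comp_lfunE adjointEr.
Qed.

Lemma hilbert_schmidt_ketbra i j b :
  hilbert_schmidt ip (ketbra ip (e i) (e j)) b = ip (e i) (b (e j)).
Proof.
rewrite hilbert_schmidtE (bigD1 j) //= ketbra_onbE eqxx scale1r big1 ?addr0 //.
by move=> k kj; rewrite ketbra_onbE eq_sym (negPf kj) ipZl rmorph0 mul0r.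
Qed.

(** This lets the lemmas of this section be reused with ['End(V)] in place of [V], in particular
    those on adjoints and square roots. *)
Lemma ketbra_orthonormal_basis :
  orthonormal_basis (hilbert_schmidt ip)
    (fun p : I * I => ketbra ip (e p.1) (e p.2)).
Proof.
split=> [f c g h|f g|[i j] [k l]|f].
- rewrite !hilbert_schmidtE mulr_sumr -big_split; apply: eq_bigr => i _ /=.
  by rewrite add_lfunE scale_lfunE ipDr ipZr.
- rewrite !hilbert_schmidtE rmorph_sum; apply: eq_bigr => i _ /=.
  exact: ip_conj.
- rewrite hilbert_schmidt_ketbra ketbra_onbE ipZr ip_onb xpair_eqE.
  by rewrite (eq_sym l) -natrM mulnb andbC.
(* At [e j] only the matrix units with second index [j] survive, and what remains is the expansion
   of [f (e j)]. *)
apply: onb_lfunP => j; rewrite sum_lfunE.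
rewrite -(pair_bigA _ (fun i k => (hilbert_schmidt ip (ketbra ip (e i) (e k)) f *:
  ketbra ip (e i) (e k)) (e j))) /=.
rewrite {1}[f (e j)]onb_expand; apply: eq_bigr => i _.
rewrite (bigD1 j) //= scale_lfunE ketbra_onbE eqxx scale1r hilbert_schmidt_ketbra.
rewrite big1 ?addr0 // => k kj.
by rewrite scale_lfunE ketbra_onbE (negPf kj) scale0r scaler0.
Qed.

(** * The modular operator on matrix units *)

Lemma modular_opE rho a : modular_op rho a = (rho \o a \o rho^-1)%VF.
Proof.
rewrite /modular_op linfun_linearE // => c u v.
by rewrite comp_lfunDr comp_lfunDl -comp_lfunZr -comp_lfunZl.
Qed.

Lemma lker0_eigenV a i c : lker a == 0%VS -> c != 0 ->
  a (e i) = c *: e i -> a^-1%VF (e i) = c^-1 *: e i.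
Proof.
move=> ka c0 ae; apply: (lker0P ka).
by rewrite lker0_lfunVK // linearZ /= ae scalerA mulVf // scale1r.
Qed.

Lemma eigen_lker0 a (l : I -> C) :
  (forall i, a (e i) = l i *: e i) -> (forall i, l i != 0) -> lker a == 0%VS.
Proof.
move=> ae l0; apply/eqP/vspaceP => f; rewrite memv0 memv_ker.
apply/idP/idP => /eqP => [af|->]; last by rewrite linear0.
apply/eqP/onb_inj => i; rewrite ip0r; apply: (mulfI (l0 i)); rewrite mulr0.
have <- : ip (e i) (a f) = l i * ip (e i) f; last by rewrite af ip0r.
rewrite {1}[f]onb_expand linear_sum.
under eq_bigr => j _ do rewrite linearZ /= ae scalerA.
by rewrite ip_expand mulrC.
Qed.

(** Left multiplication by [a] scales E_ij by l_i, right multiplication by its inverse scales it by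
    1 / l_j. It serves both for [rho] and for its square root. *)
Lemma modular_ketbra a (l : I -> C) i j :
  lker a == 0%VS ->
  (forall i, a (e i) = l i *: e i) -> (forall i, l i != 0) ->
  modular_op a (ketbra ip (e i) (e j)) = (l i / l j) *: ketbra ip (e i) (e j).
Proof.
move=> ka ae l0; rewrite modular_opE; apply: onb_lfunP => k.
rewrite !(comp_lfunE, scale_lfunE) (lker0_eigenV ka (l0 k) (ae k)) linearZ /=.
rewrite !ketbra_onbE !linearZ /= ae !scalerA.
have [->|_] := eqVneq j k; last by rewrite !(mulr0, mul0r).
by rewrite mulr1 mul1r mulrC.
Qed.

End OrthonormalBasis.

(** * Transposition as a unitary on the Hilbert-Schmidt space *)

Section Transposition.
Variables (C : numClosedFieldType) (V : vectType C) (ip : V -> V -> C).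
Variables (n : nat) (x : n.-tuple V).
Hypothesis onb : orthonormal_basis ip (tnth x).
Implicit Types a b : 'End(V).

Lemma ip_conj_op i f : ip (tnth x i) (conj_op ip x f) = (ip (tnth x i) f)^*.
Proof. exact: (ip_expand onb). Qed.

Lemma conj_op_basis i : conj_op ip x (tnth x i) = tnth x i.
Proof.
by apply: (onb_inj onb) => j; rewrite ip_conj_op (ip_onb onb) rmorph_nat.
Qed.

Lemma conj_op_antilinear c f g :
  conj_op ip x (c *: f + g) = c^* *: conj_op ip x f + conj_op ip x g.
Proof.
apply: (onb_inj onb) => i.
by rewrite (ipDr onb) (ipZr onb) !ip_conj_op (ipDr onb) (ipZr onb) rmorphD rmorphM.
Qed.

(** J_c fixes the basis and conjugates coefficients, so the entry is the conjugate of <x_i, a^*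
    x_j>. Evaluating [linfun] is legitimate because J_c, being antilinear, occurs twice. *)
Lemma transpose_entry a i j :
  ip (tnth x i) (transpose_op ip x a (tnth x j)) = ip (tnth x j) (a (tnth x i)).
Proof.
rewrite /transpose_op linfun_linearE => [|c f g]; last first.
  by rewrite conj_op_antilinear linearP conj_op_antilinear conjCK.
by rewrite ip_conj_op conj_op_basis (ip_conj onb) (adjointE onb).
Qed.

Lemma entry_inj a b :
  (forall i j, ip (tnth x i) (a (tnth x j)) = ip (tnth x i) (b (tnth x j))) ->
  a = b.
Proof. by move=> ab; apply: (onb_lfunP onb) => j; apply: (onb_inj onb). Qed.

Lemma transpose_linear : linear (transpose_op ip x).
Proof.
move=> c a b; apply: entry_inj => i j.
rewrite !(add_lfunE, scale_lfunE) (ipDr onb) (ipZr onb) !transpose_entry.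
by rewrite add_lfunE scale_lfunE (ipDr onb) (ipZr onb).
Qed.

Lemma transpose_invol : involutive (transpose_op ip x).
Proof. by move=> a; apply: entry_inj => i j; rewrite !transpose_entry. Qed.

Lemma transpose_ketbra i j :
  transpose_op ip x (ketbra ip (tnth x i) (tnth x j)) =
  ketbra ip (tnth x j) (tnth x i).
Proof.
apply: entry_inj => k l; rewrite transpose_entry !(ketbra_onbE onb) !(ipZr onb).
by rewrite !(ip_onb onb) mulrC (eq_sym l) (eq_sym j).
Qed.

(** The diagonal [r] is its own transpose; both sides have the entries s_j <x_j, a x_i>. *)
Lemma transpose_eigenM (r : 'End(V)) a (s : 'I_n -> C) :
  (forall i, r (tnth x i) = s i *: tnth x i) ->
  transpose_op ip x (r \o a)%VF = (transpose_op ip x a \o r)%VF.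
Proof.
move=> rx; apply: entry_inj => i j.
rewrite transpose_entry !comp_lfunE rx linearZ /= (ipZr onb) transpose_entry.
rewrite {1}[a (tnth x i)](onb_expand onb) linear_sum.
under eq_bigr => k _ do rewrite linearZ /= rx scalerA.
by rewrite (ip_expand onb) mulrC.
Qed.

(** Both sides sum the conjugate of a_ij times b_ji, up to exchanging the two indices. *)
Lemma transpose_hilbert_schmidt a b :
  hilbert_schmidt ip (transpose_op ip x a) b =
  hilbert_schmidt ip a (transpose_op ip x b).
Proof.
rewrite !(hilbert_schmidtE onb).
under eq_bigr => i _ do rewrite (ip_coord onb).
under [RHS]eq_bigr => i _ do rewrite (ip_coord onb).
rewrite exchange_big; apply: eq_bigr => i _; apply: eq_bigr => j _ /=.
by rewrite transpose_entry -(ip_conj onb) transpose_entry (ip_conj onb).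
Qed.

(** A self-adjoint involution is unitary: the adjoint is the map itself, and its square is the
    identity. *)
Lemma transpose_unitary :
  unitary_op (hilbert_schmidt ip) (linfun (transpose_op ip x)).
Proof.
have tE := linfun_linearE transpose_linear.
rewrite /unitary_op (adjoint_unique (ketbra_orthonormal_basis onb)
  (b := linfun (transpose_op ip x))); last first.
  by move=> a b; rewrite !tE transpose_hilbert_schmidt.
suff -> : (linfun (transpose_op ip x) \o linfun (transpose_op ip x))%VF = \1%VF by [].
by apply/lfunP => a; rewrite comp_lfunE id_lfunE !tE transpose_invol.
Qed.

End Transposition.

(** Pairing the expansion of f in coordinates with x_i leaves only the i-th coordinate, which is
    therefore <x_i, f>. *)
Lemma orthonormal_basis_of (C : numClosedFieldType) (V : vectType C)
    (form : {dot V for conjC}) (n : nat) (x : n.-tuple V) :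
  basis_of fullv x -> orthonormal form x ->
  orthonormal_basis (inner form) (tnth x).
Proof.
move=> bx /orthonormalP[ux ox].
have ip_x i j : inner form (tnth x i) (tnth x j) = (i == j)%:R.
  rewrite /inner ox ?mem_tnth // eq_sym; congr (nat_of_bool _)%:R.
  by rewrite !(tnth_nth 0) nth_uniq // size_tuple.
split=> // [f c g h|f g|f].
- by rewrite /inner linearPl.
- by rewrite /inner (hermC form g f) expr0 mul1r.
have fE := coord_basis bx (memvf f).
rewrite {1}fE; apply: eq_bigr => i _; rewrite -tnth_nth; congr (_ *: _).
rewrite {2}fE /inner.
rewrite (big_morph (form^~ (tnth x i)) (linearDl form _) (linear0l form _)).
rewrite (bigD1 i) //= linearZl_LR /= -tnth_nth.
have := ip_x i i; rewrite /inner eqxx => ->; rewrite mulr1 big1 ?addr0 // => j ji.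
rewrite linearZl_LR /= -tnth_nth; have := ip_x i j; rewrite /inner => ->.
by rewrite eq_sym (negPf ji) mulr0.
Qed.

(** * The polar decomposition of tau *)

Theorem theorem4p3 (R : realType) (H : vectType R[i])
    (form : {dot H for conjC}) (rho : 'End(H)) (n : nat) (x : n.-tuple H) :
  let ip := inner form in
  let E (i j : 'I_n) := ketbra ip (tnth x i) (tnth x j) in
  let hs := hilbert_schmidt ip in
  density_op ip rho ->
  lker rho = 0%VS ->
  basis_of fullv x ->
  orthonormal form x ->
  (forall i : 'I_n, exists l : R[i], rho (tnth x i) = l *: tnth x i) ->
  let is_tau (tau : 'End('End(H))) :=
    forall a : 'End(H),
      tau (a \o oproot ip rho)%VF = (transpose_op ip x a \o oproot ip rho)%VF in
  let is_flip (U : 'End('End(H))) := forall i j : 'I_n, U (E i j) = E j i in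
  [/\ exists! tau, is_tau tau,
      exists! U, is_flip U
    & forall tau U : 'End('End(H)), is_tau tau -> is_flip U ->
        unitary_op hs U /\ tau = (U \o oproot hs (modular_op rho))%VF].
Proof.
move=> ip E hs [rho0 _] /eqP krho bx ox eig is_tau is_flip.
have onb := orthonormal_basis_of bx ox; rewrite -/ip in onb.
have honb := ketbra_orthonormal_basis onb; rewrite -/hs in honb.
have [l rhoE] : exists l : 'I_n -> R[i], forall i, rho (tnth x i) = l i *: tnth x i.
  by have [l lE] := choice eig; exists l.
(* Positivity of [rho] gives 0 <= <x_i, rho x_i> = l_i, and l_i = 0 would put the unit vector x_i
   into the trivial kernel. *)
have l0 i : 0 < l i.
  rewrite lt_def; apply/andP; split.
    apply/eqP => li0; have := rhoE i; rewrite li0 scale0r => /eqP.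
    rewrite -memv_ker (eqP krho) memv0 => /eqP xi0.
    have := ip_onb onb i i; rewrite xi0 eqxx (ip0r onb) => /esym/eqP.
    by rewrite oner_eq0.
  by have := rho0 (tnth x i); rewrite rhoE (ipZr onb) (ip_onb onb) eqxx mulr1.
pose s i := sqrtC (l i).
have s0 i : 0 < s i by rewrite sqrtC_gt0.
have sn0 i : s i != 0 by rewrite gt_eqF.
(* The diagonal operator with entries sqrt(l_i), soon identified with rho^(1/2). *)
pose r : 'End(H) := linfun (fun f => \sum_i (ip (tnth x i) f * s i) *: tnth x i).
have rE i : r (tnth x i) = s i *: tnth x i.
  rewrite /r linfun_linearE => [|c f g]; last first.
    rewrite scaler_sumr -big_split; apply: eq_bigr => j _ /=.
    by rewrite (ipDr onb) (ipZr onb) mulrDl scalerDl scalerA mulrA.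
  apply: (onb_inj onb) => j.
  rewrite (ip_expand onb) (ipZr onb) (ip_onb onb) mulrC.
  by have [->|] := eqVneq j i; rewrite ?mulr0.
have kr := eigen_lker0 onb rE sn0.
have rootE : oproot ip rho = r.
  by apply: (oproot_eigen onb rE s0) => i; rewrite /s sqrtCK.
(* On E_ij the candidate has eigenvalue s_i / s_j > 0, whose square l_i / l_j is that of the modular
   operator of [rho]. *)
have modE : oproot hs (modular_op rho) = modular_op r.
  apply: (oproot_eigen honb (s := fun p => s p.1 / s p.2)) => [[i j]|[i j]|[i j]] /=.
  - exact: (modular_ketbra onb).
  - by rewrite divr_gt0.
  - rewrite (modular_ketbra onb _ _ krho rhoE) => [|k]; last by rewrite gt_eqF.
    by rewrite expr_div_n !sqrtCK.
pose T := linfun (transpose_op ip x).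
have TE : T =1 transpose_op ip x by exact: linfun_linearE (transpose_linear onb).
have flipT : is_flip T by move=> i j; rewrite TE (transpose_ketbra onb).
have flip_uniq U : is_flip U -> T = U.
  by move=> fU; apply: (onb_lfunP honb) => -[i j]; rewrite flipT fU.
(* Once r^-1 r cancels, the claim is (r a)^t = a^t r. *)
have tauT : is_tau (T \o modular_op r)%VF.
  move=> a; rewrite rootE comp_lfunE (modular_opE r) TE comp_lfunA lker0_compfK //.
  exact: transpose_eigenM rE.
(* Since [r] is invertible, every [xi] has the form a r with a = xi r^-1, so the defining equation
   fixes tau everywhere. *)
have tau_uniq tau : is_tau tau -> (T \o modular_op r)%VF = tau.
  move=> ttau; apply/lfunP => xi; have <- : ((xi \o r^-1) \o r)%VF = xi.
    by rewrite -comp_lfunA lker0_compVf // comp_lfun1r.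
  have := ttau (xi \o r^-1)%VF; have := tauT (xi \o r^-1)%VF; rewrite rootE.
  by move=> -> ->.
split; first by exists (T \o modular_op r)%VF.
  by exists T.
move=> tau U ttau fU; rewrite -(flip_uniq U fU) -(tau_uniq tau ttau) modE.
by split=> //; apply: transpose_unitary.
Qed.
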